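(* Let $k$ be an odd positive integer, $n=4k$, and $d=\frac{(3^{2k}+1)^2}{20}$ (an integer). Let $\alpha$ be a primitive element of $\mathrm{GF}(3^n)$ and let $\{s_t\}$ be the ternary $m$-sequence $s_t=\mathrm{Tr}_1^n(\alpha^t)$ of period $3^n-1$. Then for every shift $\tau$ with $0\le \tau\le 3^n-2$, the cross-correlation $$C_d(\tau)=\sum_{t=0}^{3^n-2}\omega^{s_{t+\tau}-s_{dt}}$$ between $\{s_t\}$ and its decimation $\{s_{dt}\}$ satisfies $$|C_d(\tau)|\le 5\cdot 3^{n/2}+1 = 5\sqrt{3^n}+1.$$
   Context: $\omega=e^{2\pi\sqrt{-1}/3}$ is a primitive complex cube root of unity. For $m\mid n$, $\mathrm{Tr}_m^n:\mathrm{GF}(3^n)\to\mathrm{GF}(3^m)$ denotes the trace map $\mathrm{Tr}_m^n(x)=x+x^{3^m}+x^{3^{2m}}+\cdots+x^{3^{(n/m-1)m}}$. Exponents $s_{t+\tau}-s_{dt}$ are elements of $\mathrm{GF}(3)=\mathbb{Z}/3\mathbb{Z}$, so $\omega^{s}$ is well defined. *)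

(* Defs.v *)
From HB Require Import structures.
From mathcomp Require Import all_boot all_order all_algebra all_field.
Set Implicit Arguments. Unset Strict Implicit. Unset Printing Implicit Defensive.
Import Order.TTheory GRing.Theory Num.Theory.
Local Open Scope ring_scope.

(* omega = e^{2 pi i/3} = (-1 + i sqrt 3)/2 *)
Definition omega : algC := (-1 + 'i * sqrtC 3%:R) / 2%:R.

Definition absTr (F : finFieldType) (n : nat) (x : F) : F :=
  \sum_(i < n) x ^+ (3 ^ i).

(* omega^s for s in the prime field GF(3) = {0,1,2} of F *)
Definition omega_pow (F : finFieldType) (s : F) : algC :=
  if s == 0 then 1 else if s == 1 then omega else omega ^+ 2.

Definition mseq (F : finFieldType) (n : nat) (alpha : F) (t : nat) : F :=
  absTr n (alpha ^+ t).

Definition crosscorr (F : finFieldType) (n : nat) (alpha : F) (d tau : nat) : algC :=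
  \sum_(t < 3 ^ n - 1) omega_pow (mseq n alpha (t + tau) - mseq n alpha (d * t)).

(* Main.v *)
Require Import Defs.
From HB Require Import structures.
From mathcomp Require Import all_boot all_order all_fingroup all_algebra all_field.
From mathcomp Require Import zify ring.
Set Implicit Arguments.
Unset Strict Implicit.
Unset Printing Implicit Defensive.
Import Order.TTheory GRing.Theory Num.Theory.
Local Open Scope ring_scope.

(** Let [Q = 3 ^ (2 * k)], so that [F] has [Q ^ 2] elements, and let [chi] be the canonical
    additive character of [F]. Up to [-1], the correlation is the sum [X a] of
    [chi (a * x - x ^+ d)] over [F], where [a = alpha ^+ tau]. On nonsquares [x ^+ d] has trace
    zero, so up to a Gauss sum of modulus [Q] only the sum [T a] over the nonzero squares
    matters.

    Writing squares as [delta * y ^+ 10], with [delta] of norm 1 over GF(Q) in one of five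
    classes, turns [x ^+ d] into [y ^+ (Q + 1)] up to sign. Hence [T a + T (- a)] is a sum of ten sums
    [hsum c] of [chi (c * y ^+ 10 - y ^+ (Q + 1))], which are Hermitian forms over
    GF(81)/GF(9): [hsum c = - Q * (-9) ^ v] with [v] the dimension of the radical. A radical
    line yields a solution [p] of [p * (p ^+ (9 * Q) + 1) = - N c], where [N c] is the same for
    all ten values of [c]; three distinct solutions force the values of [c] they come from to
    coincide. So either one [v] is 2 and the others are 0, or at most two are 1 and the others
    are 0.

    As for [T a - T (- a)], it vanishes when [a] is not a square. When [a] is a square one may
    take [a] in GF(Q); splitting [w = p + j * q] over GF(Q) then writes the difference in terms
    of Gauss sums and quadratic sums over GF(Q), whose products are again [hsum a] and
    [hsum (- a)]. It is at most [6 * Q], and it is 0 when some [v] is 2. *)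

(** * Sums over roots of unity *)

Lemma sum_unity_roots (F : finFieldType) (V : nmodType) n (z : F) (f : F -> V) :
  n.-primitive_root z ->
  \sum_(x | x ^+ n == 1) f x = \sum_(t < n) f (z ^+ t).
Proof.
move=> prz; rewrite -(big_imset f (h := fun t : 'I_n => z ^+ t)) /=.
  apply: eq_bigl => x; apply/eqP/imsetP => [/(prim_rootP prz)[i ->]|[i _ ->]].
    by exists i.
  by rewrite exprAC (prim_expr_order prz) expr1n.
move=> i j _ _ /= /eqP; rewrite (eq_prim_root_expr prz) !modn_small ?ltn_ord //.
by move/eqP/val_inj.
Qed.

Lemma finfield_unity_root (F : finFieldType) (x : F) :
  (x ^+ #|F|.-1 == 1) = (x != 0).
Proof.
have F_gt1 : (1 < #|F|)%N := card_finNzRing_gt1 F.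
have N_gt0 : (0 < #|F|.-1)%N by rewrite ltn_predRL.
apply/idP/idP => [|xn0]; last first.
  by apply/eqP/(mulIf xn0); rewrite mul1r -exprSr prednK ?expf_card ?(ltnW F_gt1).
apply: contraTneq => ->; rewrite expr0n.
by case: #|F|.-1 N_gt0 => [|n] //=; rewrite eq_sym oner_eq0.
Qed.

Section PowerSums.

Variables (F : finFieldType) (alpha : F).
Hypothesis pr_alpha : (#|F|.-1).-primitive_root alpha.

Lemma sum_neq0_prim_root (V : nmodType) (f : F -> V) :
  \sum_(x | x != 0) f x = \sum_(t < #|F|.-1) f (alpha ^+ t).
Proof.
by rewrite -(sum_unity_roots _ pr_alpha); apply: eq_bigl => x; rewrite finfield_unity_root.
Qed.

Lemma prim_root_cofactor e e' : (e * e')%N = #|F|.-1 ->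
  e'.-primitive_root (alpha ^+ e).
Proof.
move=> ee'; have N_gt0 := prim_order_gt0 pr_alpha.
have e_gt0 : (0 < e)%N by case: e ee' N_gt0 => [<-|].
have -> : e = (#|F|.-1 %/ e')%N.
  by rewrite -ee' mulnK //; case: e' ee' N_gt0 => [|//]; rewrite muln0 => <-.
by apply: (dvdn_prim_root pr_alpha); rewrite -ee' dvdn_mull.
Qed.

Lemma card_unity_roots e e' : (e * e')%N = #|F|.-1 ->
  #|[pred u : F | u ^+ e == 1]| = e.
Proof.
move=> ee'; have pr := @prim_root_cofactor e' e; rewrite mulnC in pr.
by rewrite -sum1_card (sum_unity_roots (fun=> 1%N) (pr ee')) sum_nat_const card_ord muln1.
Qed.

(** Raising to the power [e] maps the units onto the [e']-th roots of unity, and each fibre is a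
    coset of the group of [e]-th roots of unity. *)
Lemma sum_powers (f : F -> algC) e e' : (e * e')%N = #|F|.-1 ->
  \sum_(y | y != 0) f (y ^+ e) = e%:R * \sum_(x | x ^+ e' == 1) f x.
Proof.
move=> ee'; rewrite (partition_big (fun y => y ^+ e) (fun x => x ^+ e' == 1)) /=; last first.
  by move=> y; rewrite -finfield_unity_root -exprM ee'.
rewrite mulr_sumr; apply: eq_bigr => x /eqP xe'.
have [i Dx] := prim_rootP (prim_root_cofactor ee') xe'.
have an0 : alpha != 0 by rewrite -finfield_unity_root (prim_expr_order pr_alpha).
have ain0 : alpha ^+ i != 0 by rewrite expf_neq0.
rewrite (eq_bigr (fun=> f x)) => [|y /andP[_ /eqP->] //].
have [e_gt0 e'_gt0] : (0 < e)%N /\ (0 < e')%N.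
  by have := prim_order_gt0 pr_alpha; rewrite -ee' muln_gt0 => /andP.
rewrite (reindex_onto (fun u => alpha ^+ i * u) (fun y => y / alpha ^+ i)) /=; last first.
  by move=> y _; rewrite mulrC divfK.
rewrite sumr_const -[LHS]mulr_natl; congr (_%:R * _).
rewrite -[RHS](card_unity_roots ee'); apply: eq_card => u; rewrite [RHS]inE [LHS]unfold_in.
rewrite (mulrC (alpha ^+ i) u) mulfK // eqxx andbT exprMn mulf_eq0 negb_or ain0 andbT.
rewrite -[alpha ^+ i ^+ e]exprM mulnC exprM -Dx.
have xn0 : x != 0.
  by apply: contra_eq_neq xe' => ->; rewrite expr0n gtn_eqF //= eq_sym oner_eq0.
rewrite -{2}(mul1r x) (inj_eq (mulIf xn0)); case: (u ^+ e =P 1) => [ue|]; last by rewrite andbF.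
rewrite andbT; apply: contra_eq_neq ue => ->.
by rewrite expr0n gtn_eqF //= eq_sym oner_eq0.
Qed.

End PowerSums.

(** * The canonical additive character *)

Lemma omega_root : omega ^+ 2 + omega + 1 = 0.
Proof.
have n2 : (2%:R : algC) != 0 by rewrite pnatr_eq0.
have E : ('i * sqrtC 3%:R : algC) ^+ 2 = - 3%:R by rewrite exprMn sqrCi sqrtCK mulN1r.
rewrite /omega; set y := 'i * _ in E *.
apply: (mulIf (mulf_neq0 n2 n2)); rewrite mul0r.
transitivity (y ^+ 2 + 3%:R); last by rewrite E addNr.
by field.
Qed.

Lemma omega_cube : omega ^+ 3 = 1.
Proof.
apply/eqP; rewrite -subr_eq0; apply/eqP.
by transitivity ((omega - 1) * (omega ^+ 2 + omega + 1)); [ring | rewrite omega_root mulr0].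
Qed.

Lemma omega_neq1 : omega != 1.
Proof.
apply/eqP => E; have := omega_root; rewrite E expr1n => /eqP.
by rewrite (_ : 1 + 1 + 1 = 3%:R); [rewrite pnatr_eq0 | ring].
Qed.

Section TraceCharacter.

Variables (F : finFieldType) (n : nat).
Hypothesis char3 : 3 \in [pchar F].

Lemma natr3 : 3%:R = 0 :> F. Proof. exact: pcharf0. Qed.

Lemma addrr_char3 (x : F) : x + x = - x.
Proof.
by apply/eqP; rewrite -subr_eq0 opprK -mulr2n -mulrSr -mulr_natl natr3 mul0r.
Qed.

Lemma expr3XD (x y : F) i : (x + y) ^+ (3 ^ i) = x ^+ (3 ^ i) + y ^+ (3 ^ i).
Proof. by rewrite exprDn_pchar // pnatX pnatE ?char3. Qed.

Lemma expr3XN (x : F) i : (- x) ^+ (3 ^ i) = - x ^+ (3 ^ i).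
Proof. by rewrite exprNn -signr_odd oddX orbT expr1 mulN1r. Qed.

Lemma F3_cases (s : F) : s ^+ 3 = s -> [\/ s = 0, s = 1 | s = -1].
Proof.
move=> s3; have : s * ((s - 1) * (s + 1)) = 0.
  by transitivity (s ^+ 3 - s); [ring | rewrite s3 subrr].
move/eqP; rewrite !mulf_eq0 subr_eq0 addr_eq0.
by case/or3P => /eqP; [constructor 1|constructor 2|constructor 3].
Qed.

Lemma oneN_neq1 : -1 != 1 :> F.
Proof.
by rewrite -subr_eq0 -opprD oppr_eq0 addrr_char3 oppr_eq0 oner_eq0.
Qed.

Lemma omega_powE : (omega_pow (0 : F) = 1) * (omega_pow (1 : F) = omega)
  * (omega_pow (-1 : F) = omega ^+ 2).
Proof.
by rewrite /omega_pow !eqxx oner_eq0 oppr_eq0 oner_eq0 (negPf oneN_neq1).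
Qed.

(** Being fixed by cubing means lying in GF(3); on other elements [omega_pow] only returns the
    default [omega ^+ 2]. *)
Lemma omega_powD (s t : F) : s ^+ 3 = s -> t ^+ 3 = t ->
  omega_pow (s + t) = omega_pow s * omega_pow t.
Proof.
have o4 : omega ^+ 2 * omega ^+ 2 = omega by rewrite -exprD exprS omega_cube mulr1.
case/F3_cases=> ->; case/F3_cases=> ->;
  rewrite ?addr0 ?add0r ?subrr ?addNr ?addrr_char3 ?opprK !omega_powE ?mul1r ?mulr1 //.
- by rewrite -exprS omega_cube.
- by rewrite -exprSr omega_cube.
Qed.

Hypothesis cardF : #|F| = (3 ^ n)%N.

Lemma absTrD (x y : F) : absTr n (x + y) = absTr n x + absTr n y.
Proof.
by rewrite /absTr -big_split /=; apply: eq_bigr => i _; rewrite expr3XD.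
Qed.

(** Cubing permutes the summands cyclically, because [x ^+ (3 ^ n) = x]. *)
Lemma absTr_frob (x : F) : absTr n (x ^+ 3) = absTr n x.
Proof.
rewrite /absTr; case: n cardF => [|n'] c; first by rewrite !big_ord0.
rewrite big_ord_recr big_ord_recl /= addrC -exprM -expnS -c expf_card.
by congr (_ + _); apply: eq_bigr => i _; rewrite -exprM -expnS.
Qed.

Lemma absTr_cube (x : F) : absTr n x ^+ 3 = absTr n x.
Proof.
rewrite -[RHS]absTr_frob /absTr.
elim/big_ind2: _ => [|a b c e <- <-|i _]; first by rewrite expr0n.
  exact: (expr3XD _ _ 1).
by rewrite exprAC.
Qed.

Definition trace_char (x : F) : algC := omega_pow (absTr n x).

Lemma trace_charD x y : trace_char (x + y) = trace_char x * trace_char y.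
Proof. by rewrite /trace_char absTrD omega_powD // absTr_cube. Qed.

Lemma trace_char_frob x : trace_char (x ^+ 3) = trace_char x.
Proof. by rewrite /trace_char absTr_frob. Qed.

Lemma absTrB (x y : F) : absTr n (x - y) = absTr n x - absTr n y.
Proof. by apply/eqP; rewrite eq_sym subr_eq -absTrD subrK. Qed.

Lemma trace_char_nontrivial : (0 < n)%N -> exists x, trace_char x != 1.
Proof.
move=> n_gt0; case: (pickP (fun x => trace_char x != 1)) => [x|c1]; first by exists x.
have tr0 (x : F) : absTr n x = 0.
  move/negbFE/eqP: (c1 x); rewrite /trace_char.
  case/F3_cases: (absTr_cube x) => -> //; rewrite omega_powE => /eqP.
    by rewrite (negPf omega_neq1).
  move=> /eqP o2; have := omega_neq1; rewrite -[omega]mulr1 -[X in _ * X]o2.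
  by rewrite -exprS omega_cube eqxx.
(* If every trace vanished, this nonzero polynomial of degree below [#|F|] would have all of [F] as
   roots. *)
pose p : {poly F} := \sum_(i < n) 'X^(3 ^ i).
have size_p : (size p <= #|F|)%N.
  rewrite cardF; apply: (leq_trans (size_sum _ _ _)); apply/bigmax_leqP => i _.
  by rewrite size_polyXn ltn_exp2l.
have p0 : p != 0.
  apply/eqP => /(congr1 (fun r : {poly F} => r`_1)); rewrite coef0 coef_sum.
  case: n n_gt0 => // n' _; rewrite big_ord_recl big1 => [|i _].
    by rewrite coefXn addr0 => /eqP; rewrite oner_eq0.
  rewrite coefXn eq_sym; case: eqP => // /eqP; rewrite -[X in _ == X](expn0 3) eqn_exp2l //.
have := max_poly_roots p0 (rs := enum F).
rewrite enum_uniq -cardE ltnNge size_p => H; suff: false by []; apply: H => //.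
apply/allP => x _; apply/eqP; rewrite horner_sum -[RHS](tr0 x).
by apply: eq_bigr => i _; rewrite hornerXn.
Qed.

End TraceCharacter.

(** * Quadratic exponential sums *)

Section CrossCorrelation.

Variables (F : finFieldType) (alpha : F) (Q k s : nat) (chi : F -> algC).
Hypothesis char3 : 3 \in [pchar F].
Hypothesis Q_pow3 : Q = (3 ^ (2 * k))%N.
Hypothesis Q_mod80 : Q = (80 * s + 9)%N.
Hypothesis cardF : #|F| = (Q ^ 2)%N.
Hypothesis pr_alpha : (#|F|.-1).-primitive_root alpha.
Hypothesis chiD : forall x y, chi (x + y) = chi x * chi y.
Hypothesis chi0 : chi 0 = 1.
Hypothesis chi_frob : forall x, chi (x ^+ 3) = chi x.
Hypothesis chi_nontrivial : exists x, chi x != 1.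

(* With [Q = 80 * s + 9]: [kappa = (Q ^ 2 - 1) / 80], [m = (Q + 1) / 10],
   [d = (Q + 1) ^ 2 / 20]. *)
Local Notation kappa := ((10 * s + 1) * (8 * s + 1))%N.
Local Notation m := (8 * s + 1)%N.
Local Notation d := (5 * (8 * s + 1) ^ 2)%N.

Lemma card_units : #|F|.-1 = (80 * kappa)%N.
Proof. rewrite cardF Q_mod80; nia. Qed.


Lemma chi_cube x : chi x ^+ 3 = 1.
Proof.
rewrite -chi0 -[in RHS](mulr0 x) -(natr3 char3) mulr_natr !mulrSr mulr0n add0r.
by rewrite !chiD; ring.
Qed.

Lemma chi_neq0 x : chi x != 0.
Proof.
by apply/eqP => x0; have := chi_cube x; rewrite x0 expr0n => /eqP; rewrite eq_sym oner_eq0.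
Qed.

Lemma norm_chi x : `|chi x| = 1.
Proof.
by apply/eqP; rewrite -(@pexpr_eq1 _ _ 3) ?normr_ge0 // -normrX chi_cube normr1.
Qed.

Lemma chiN x : chi (- x) = (chi x)^*.
Proof.
apply: (mulIf (chi_neq0 x)); rewrite -chiD addNr chi0 mulrC -normCK norm_chi.
by rewrite expr1n.
Qed.

Lemma chi_eq1 x : chi x = chi (- x) -> chi x = 1.
Proof.
move=> E; have x2 : chi x * chi x = 1 by rewrite {2}E -chiD subrr chi0.
by rewrite -(chi_cube x) exprS expr2 x2 mulr1.
Qed.

Lemma chi_expr3X i x : chi (x ^+ (3 ^ i)) = chi x.
Proof. by elim: i => [|i IH]; rewrite ?expr1 // expnSr exprM chi_frob. Qed.

Lemma chi_expr9 x : chi (x ^+ 9) = chi x. Proof. exact: (chi_expr3X 2). Qed.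

Lemma chi_conj x : chi (x ^+ Q) = chi x. Proof. by rewrite Q_pow3 chi_expr3X. Qed.

Lemma conjD (x y : F) : (x + y) ^+ Q = x ^+ Q + y ^+ Q.
Proof. by rewrite Q_pow3 expr3XD. Qed.

Lemma conjN (x : F) : (- x) ^+ Q = - x ^+ Q.
Proof. by rewrite Q_pow3 expr3XN. Qed.

Lemma expr9D (x y : F) : (x + y) ^+ 9 = x ^+ 9 + y ^+ 9.
Proof. exact: (expr3XD char3 x y 2). Qed.

Lemma conjK (x : F) : x ^+ Q ^+ Q = x.
Proof. by rewrite -exprM mulnn -cardF expf_card. Qed.

(** Such [x] has trace 0 over GF(Q): conjugation gives [chi x = chi (- x)], so the cube root of
    unity [chi x] squares to 1. *)
Lemma chi_conjN x : x ^+ Q = - x -> chi x = 1.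
Proof. by move=> E; apply: chi_eq1; rewrite -E chi_conj. Qed.

Lemma Q_gt0 : (0 < Q)%N. Proof. by rewrite Q_pow3 expn_gt0. Qed.

Lemma sum_chi_mul c :
  \sum_y chi (y * c) = if c == 0 then (Q ^ 2)%:R else 0.
Proof.
case: eqP => [->|/eqP cn0].
  under eq_bigr do rewrite mulr0 chi0.
  by rewrite sumr_const cardF.
case: chi_nontrivial => x x1; have c1 : chi (x / c * c) - 1 != 0 by rewrite divfK // subr_eq0.
apply: (mulfI c1); rewrite mulr0 mulrBl mul1r; apply/eqP; rewrite subr_eq0; apply/eqP.
rewrite mulr_sumr [RHS](reindex_inj (addrI (x / c))) /=.
by apply: eq_bigr => y _; rewrite mulrDl chiD.
Qed.

Definition subQ := [set x : F | x ^+ Q == x].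

Lemma subQP x : reflect (x ^+ Q = x) (x \in subQ).
Proof. by rewrite inE; apply: eqP. Qed.

Lemma subQ0 : 0 \in subQ.
Proof. by apply/subQP; rewrite expr0n gtn_eqF ?Q_gt0. Qed.

Lemma subQ1 : 1 \in subQ. Proof. by apply/subQP; rewrite expr1n. Qed.

Lemma subQD x y : x \in subQ -> y \in subQ -> x + y \in subQ.
Proof. by move=> /subQP Kx /subQP Ky; apply/subQP; rewrite conjD Kx Ky. Qed.

Lemma subQN x : x \in subQ -> - x \in subQ.
Proof. by move=> /subQP Kx; apply/subQP; rewrite conjN Kx. Qed.

Lemma subQM x y : x \in subQ -> y \in subQ -> x * y \in subQ.
Proof. by move=> /subQP Kx /subQP Ky; apply/subQP; rewrite exprMn Kx Ky. Qed.

Lemma subQX x i : x \in subQ -> x ^+ i \in subQ.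
Proof. by move=> /subQP Kx; apply/subQP; rewrite exprAC Kx. Qed.

Lemma subQV x : x \in subQ -> x^-1 \in subQ.
Proof. by move=> /subQP Kx; apply/subQP; rewrite exprVn Kx. Qed.

Lemma card_subQ : #|subQ| = Q.
Proof.
have e : ((80 * s + 8) * (80 * s + 10))%N = #|F|.-1 by rewrite card_units; nia.
rewrite (cardD1 0) subQ0 -[RHS](_ : 1 + (80 * s + 8) = Q)%N; last by rewrite Q_mod80; lia.
congr addn; rewrite -[RHS](card_unity_roots pr_alpha e); apply: eq_card => x.
rewrite !inE Q_mod80 (_ : 80 * s + 9 = (80 * s + 8).+1)%N; last by lia.
case: eqP => [->|/eqP xn0] /=; first by rewrite expr0n addn_eq0 andbF /= eq_sym oner_eq0.
by rewrite exprS -{3}(mulr1 x) (inj_eq (mulfI xn0)).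
Qed.

Lemma sum_chi_mul_subQ c : c \in subQ ->
  \sum_(y in subQ) chi (y * c) = if c == 0 then Q%:R else 0.
Proof.
move=> Kc; case: eqP => [->|/eqP cn0].
  under eq_bigr do rewrite mulr0 chi0.
  by rewrite sumr_const card_subQ.
(* The relative trace [z] of [x / c] lies in GF(Q), and [chi (z * c) = chi x ^+ 2], which is not
   1. *)
case: chi_nontrivial => x x1; pose z := x / c + (x / c) ^+ Q.
have Kz : z \in subQ by apply/subQP; rewrite conjD conjK addrC.
have c1 : chi (z * c) - 1 != 0.
  rewrite subr_eq0; apply: contra x1 => /eqP; rewrite mulrDl chiD.
  rewrite -{4}(subQP _ Kc) -exprMn chi_conj divfK // => x2.
  by rewrite -(chi_cube x) exprS expr2 x2 mulr1.
apply: (mulfI c1); rewrite mulr0 mulrBl mul1r; apply/eqP; rewrite subr_eq0; apply/eqP.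
rewrite mulr_sumr [RHS](reindex_inj (addrI z)) /=.
apply: eq_big => [y|y _]; last by rewrite (mulrDl z) chiD.
apply/idP/idP => [Ky|Kzy]; first exact: subQD.
by rewrite -(addKr z y) subQD ?subQN.
Qed.

(* The hypothesis on [L] says that [y * L w] represents the polar form of [f]
   and that a nonzero [L w] induces a nontrivial character of [A]. *)
Lemma norm_quadratic_sum (A : {set F}) (f L : F -> F) :
    (forall y w, y \in A -> w \in A -> y + w \in A) ->
    (forall w, w \in A -> - w \in A) ->
    (forall w, f (- w) = f w) ->
    (forall y w, y \in A -> w \in A ->
       chi (f (y + w)) = chi (f y) * chi (f w) * chi (y * L w)) ->
    (forall w, w \in A ->
       \sum_(y in A) chi (y * L w) = if L w == 0 then #|A|%:R else 0) ->
  `|\sum_(y in A) chi (f y)| ^+ 2 = (#|A| * #|[set w in A | L w == 0]|)%:R.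
Proof.
move=> AD AN fN fD orth; rewrite normCK rmorph_sum /= mulr_sumr.
transitivity (\sum_(y in A) \sum_(w in A) chi (f w) * chi (y * L w)).
  apply: eq_bigr => y Ay; rewrite mulr_suml (reindex_inj (addrI y)) /=.
  apply: eq_big => [w|w Aw].
    apply/idP/idP => [Ayw|Aw]; last exact: AD.
    by rewrite -(addKr y w) AD ?AN.
  have Aw' : w \in A by rewrite -(addKr y w) AD ?AN.
  transitivity (chi (f y) * chi (- f y) * (chi (f w) * chi (y * L w))).
    by rewrite fD // -chiN; ring.
  by rewrite -chiD subrr chi0 mul1r.
rewrite exchange_big /=.
transitivity (\sum_(w in A) if L w == 0 then #|A|%:R else 0 : algC).
  apply: eq_bigr => w Aw; rewrite -mulr_sumr orth //; case: eqP => [Lw|]; rewrite ?mulr0 //.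
  (* Here [chi (f (w + w)) = chi (f w) ^+ 2], while [w + w = - w] and [f] is even. *)
  suff -> : chi (f w) = 1 by rewrite mul1r.
  apply: (mulfI (chi_neq0 (f w))); have := fD w w Aw Aw.
  by rewrite addrr_char3 // fN Lw mulr0 chi0 !mulr1 => <-.
rewrite -big_mkcondr /= sumr_const natrM mulr_natr; congr (_ *+ _).
by apply: eq_card => w; rewrite !inE.
Qed.

(** * Hermitian forms *)

Definition hform (c y : F) := c * y ^+ 10 - y ^+ Q.+1.
Definition hsum c := \sum_y chi (hform c y).
(* The radical of the polar form of [hform c]. *)
Definition hrad (c : F) :=
  [set w | c ^+ 9 * w ^+ 81 + c * w + w ^+ (Q * 9) == 0].

(** This exponent is [Q ^ 2 / 9]; it inverts the ninth power map. *)
Let root9 := (Q %/ 9 * Q)%N.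

Lemma root9K (x : F) : x ^+ root9 ^+ 9 = x.
Proof.
rewrite -exprM -[RHS]expf_card cardF /root9 mulnAC divnK ?mulnn // Q_pow3.
case: k Q_pow3 Q_mod80 => [-> /=|n _ _]; first by lia.
by rewrite mulnS expnD dvdn_mulr.
Qed.

Lemma chi_root9 x y : chi (x * y ^+ 9) = chi (y * x ^+ root9).
Proof. by rewrite -[RHS]chi_expr9 exprMn root9K mulrC. Qed.

Lemma expr10D (x y : F) : (x + y) ^+ 10 = (x ^+ 9 + y ^+ 9) * (x + y).
Proof. by rewrite exprSr expr9D. Qed.

Lemma norm_hsum c : `|hsum c| ^+ 2 = (Q ^ 2 * #|hrad c|)%:R.
Proof.
(* Isolating [y] in the polar form costs a ninth root of [c * w]; the ninth power of [L w = 0] is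
   the equation of [hrad]. *)
pose L w := c * w ^+ 9 + (c * w) ^+ root9 + w ^+ Q.
have EL : hrad c = [set w in [set: F] | L w == 0].
  apply/setP => w; rewrite !inE /= -[RHS](expf_eq0 _ 9) /L !expr9D root9K exprMn.
  by rewrite -!exprM.
rewrite EL -cardF -cardsT -(@norm_quadratic_sum setT (hform c)) =>
  [|y w _ _|w _|w|y w _ _|w _]; rewrite ?inE //.
- by rewrite /hsum; congr (`|_| ^+ 2); apply: eq_bigl => y; rewrite inE.
- by rewrite /hform !exprSr conjN; ring.
- have -> : hform c (y + w) = hform c y + hform c w
      + (y * (c * w ^+ 9) + c * w * y ^+ 9 - (y * w ^+ Q) - y ^+ Q * w).
    by rewrite /hform expr10D [(y + w) ^+ _]exprSr conjD !exprSr; ring.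
  rewrite 2!chiD; congr (_ * _ * _); rewrite 3!chiD chi_root9.
  have -> : chi (- (y ^+ Q * w)) = chi (- (y * w ^+ Q)).
    by rewrite -[RHS]chi_conj conjN exprMn conjK.
  by rewrite -!chiD; congr chi; rewrite -addrA -opprD addrr_char3 // /L; ring.
- under eq_bigl do rewrite inE.
  by rewrite sum_chi_mul cardsT cardF.
Qed.

Let an0 : alpha != 0.
Proof. by rewrite -finfield_unity_root (prim_expr_order pr_alpha). Qed.

Lemma alphaN : alpha ^+ (40 * kappa) = -1.
Proof.
have : alpha ^+ (40 * kappa) ^+ 2 == 1.
  by rewrite -exprM -(prim_expr_order pr_alpha) card_units; apply/eqP; congr (_ ^+ _); lia.
rewrite -[X in _ == X](expr1n _ 2) eqf_sqr => /orP[|/eqP //].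
rewrite -(prim_order_dvd pr_alpha) card_units => /dvdn_leq; lia.
Qed.

(** The multiplier is a primitive 20th root of unity: its tenth power is -1, and so is its power
    [Q + 1 = 10 * m], as [m] is odd. *)
Lemma hform_iota c y : hform c (alpha ^+ (4 * kappa) * y) = - hform c y.
Proof.
rewrite /hform !exprMn -!exprM.
have -> : (4 * kappa * 10 = 40 * kappa)%N by lia.
have -> : (4 * kappa * Q.+1 = 40 * kappa * m)%N by rewrite Q_mod80; lia.
by rewrite [alpha ^+ (_ * m)]exprM alphaN -signr_odd oddD oddM /= expr1; ring.
Qed.

Lemma sum_chi_odd_real (A : {set F}) (f : F -> F) u : u != 0 ->
  (forall y, (u * y \in A) = (y \in A)) ->
  (forall y, f (u * y) = - f y) -> \sum_(y in A) chi (f y) \is Num.real.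
Proof.
move=> un0 Au fu; apply/CrealP; rewrite rmorph_sum /= [RHS](reindex_inj (mulfI un0)) /=.
by apply: eq_big => [y|y _]; rewrite ?Au // fu chiN.
Qed.

Lemma hsum_real c : hsum c \is Num.real.
Proof.
rewrite /hsum -(eq_bigl _ _ (fun y => in_setT y)).
apply: (@sum_chi_odd_real _ _ (alpha ^+ (4 * kappa))) => [|y|y]; rewrite ?inE ?expf_neq0 //.
exact: hform_iota.
Qed.

Lemma chi_Aint x : chi x \in Aint.
Proof. by apply: (@Aint_unity_root 3) => //; apply/unity_rootP/chi_cube. Qed.

(* [hform c] is invariant under the tenth roots of unity; the congruence fixes the sign
   of [hsum c], which is real of known modulus. *)
Lemma hsum_mod10 c : (hsum c - 1) / 10%:R \in Aint.
Proof.
have E : (10 * (8 * kappa))%N = #|F|.-1 by rewrite card_units; lia.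
have -> : hsum c = 1 + 10%:R * \sum_(x | x ^+ (8 * kappa) == 1) chi (c * x - x ^+ m).
  rewrite -(sum_powers pr_alpha _ E) /hsum (bigD1 0) //=; congr (_ + _).
    by rewrite /hform !expr0n /= mulr0 subr0 chi0.
  apply: eq_bigr => y _; rewrite /hform -exprM; congr (chi (_ - _ ^+ _)).
  by rewrite Q_mod80; lia.
rewrite addrC addKr mulrC mulKf ?pnatr_eq0 //.
by apply: rpred_sum => x _; apply: chi_Aint.
Qed.

(** The modulus leaves only the sign open. Modulo 10, [Q * (-9) ^ v] is -1 while [hsum c] is 1; the
    wrong sign would make 1/5 an algebraic integer. *)
Lemma hsum_eq c v : #|hrad c| = (81 ^ v)%N -> hsum c = - Q%:R * (- 9%:R) ^+ v.
Proof.
move=> cr; have : hsum c ^+ 2 == (Q%:R * (- 9%:R) ^+ v) ^+ 2.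
  rewrite -real_normK ?hsum_real // norm_hsum cr exprMn (exprAC (- 9%:R)) sqrrN.
  by rewrite -!natrX -natrM.
rewrite eqf_sqr mulNr => /orP[/eqP H|/eqP //].
have := hsum_mod10 c; rewrite H => A.
have [z Hz] : exists z : int, Q%:R * (- 9%:R) ^+ v = -1 + 10%:R * z%:~R :> algC.
  elim: v {cr H A} => [|v [z IH]].
    by exists m%:Z; rewrite expr0 mulr1 Q_mod80; ring.
  by exists (1 - 9 * z)%R; rewrite exprS mulrCA IH rmorphB rmorphM /=; ring.
have : 5%:R^-1 \in Aint.
  rewrite -[_^-1](_ : z%:~R - (Q%:R * (- 9%:R) ^+ v - 1) / 10%:R = _); last by rewrite Hz; field.
  by rewrite rpredB // rpred_int.
have Q5 : (5%:R^-1 : algC) \in Crat by rewrite rpredV rpred_nat.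
move/(Cint_rat_Aint Q5)/intrP => [t Ht]; exfalso.
have : ((5 * t)%R)%:~R = 1%:~R :> algC by rewrite intrM -Ht; field.
by move/intr_inj; lia.
Qed.

(** A label for the GF(81)-line through [w]: since 80 divides [Q - 9], it is unchanged under 80th
    roots of unity, and [eq_hquot] gives the converse. *)
Definition hquot (c w : F) := c * w ^+ 9 / w ^+ Q.
Definition hquots c := [set hquot c w | w in hrad c :\ 0].

Lemma expf_units (x : F) : x != 0 -> x ^+ (80 * kappa) = 1.
Proof. by rewrite -finfield_unity_root card_units => /eqP. Qed.

(** The radical equation divided by [w ^+ (9 * Q)] reads [p ^+ 9 + 1 = - c * w / w ^+ (9 * Q)],
    while [p ^+ Q = c ^+ Q * w ^+ (9 * Q) / w]. The [kappa]-th power kills [w ^+ 9 / w ^+ Q], so [p]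
    remembers [c ^+ kappa]. *)
Lemma hquotsP (c p : F) : c != 0 -> p \in hquots c ->
  [/\ p != 0, p ^+ kappa = c ^+ kappa & p ^+ Q * (p ^+ 9 + 1) = - c ^+ Q.+1].
Proof.
move=> cn0 /imsetP[w]; rewrite !inE => /andP[wn0 /eqP rw] ->; rewrite /hquot.
have wQ : w ^+ Q != 0 by rewrite expf_neq0.
split; first by rewrite !mulf_neq0 ?invr_eq0 ?expf_neq0.
  rewrite exprMn (exprMn _ c) exprVn -!exprM.
  rewrite (_ : Q * kappa = 80 * kappa * s + 9 * kappa)%N; last first.
    by rewrite Q_mod80; ring.
  rewrite exprD.
  rewrite (exprM w (80 * kappa)) expf_units // expr1n mul1r.
  by rewrite mulfK // expf_neq0.
rewrite (exprMn _ (c * _)) (exprMn _ c) exprVn conjK.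
rewrite (exprMn _ (c * _)) (exprMn _ c) exprVn -!exprM (_ : 9 * 9 = 81)%N // (mulnC 9 Q).
have wQ9 : w ^+ (Q * 9) != 0 by rewrite expf_neq0.
have -> : c ^+ 9 * w ^+ 81 / w ^+ (Q * 9) + 1 = (c ^+ 9 * w ^+ 81 + w ^+ (Q * 9)) / w ^+ (Q * 9).
  by rewrite mulrDl divff.
have -> : c ^+ 9 * w ^+ 81 + w ^+ (Q * 9) = - (c * w).
  by apply/eqP; rewrite -subr_eq0 opprK -[X in _ == X]rw; apply/eqP; ring.
by rewrite exprS; field; rewrite wn0 andbT expf_neq0.
Qed.

Lemma hquotsP_conj (c p : F) : c != 0 -> p \in hquots c ->
  p * (p ^+ (Q * 9) + 1) = - c ^+ Q.+1.
Proof.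
move=> cn0 /(hquotsP cn0)[_ _ /(congr1 (fun x => x ^+ Q))].
rewrite exprMn conjK conjD expr1n -!exprM conjN -exprM (mulnC 9) => ->.
by rewrite mulSn exprD [_ ^+ (Q * Q)]exprM conjK exprSr.
Qed.

(** Eliminating [p ^+ (9 * Q)] between the conjugate equation and the ninth power of the original
    one leaves a polynomial of degree 82, the number of lines in a plane over GF(81). *)
Lemma card_hquots_le82 (c : F) : c != 0 -> (#|hquots c| <= 82)%N.
Proof.
move=> cn0; pose n0 := c ^+ Q.+1.
pose p : {poly F} := 'X^82 + n0%:P * 'X^81 + (1 - n0 ^+ 9)%:P * 'X + n0%:P.
have sz : size p = 83.
  rewrite /p -!addrA size_polyDl size_polyXn // ltnS.
  apply: (leq_trans (size_polyD _ _)); rewrite geq_max; apply/andP; split.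
    by rewrite (leq_trans (size_polyMleq _ _)) // size_polyXn size_polyC; case: eqP.
  apply: (leq_trans (size_polyD _ _)); rewrite geq_max; apply/andP; split.
    by rewrite (leq_trans (size_polyMleq _ _)) // size_polyX size_polyC; case: eqP.
  by rewrite size_polyC; case: eqP.
have pn0 : p != 0 by rewrite -size_poly_eq0 sz.
suff: (size (enum (hquots c)) < size p)%N by rewrite sz -cardE ltnS.
apply: max_poly_roots (enum_uniq _) => //.
apply/allP => x; rewrite mem_enum => xc; have [xn0 _ E1] := hquotsP cn0 xc.
have E2 := hquotsP_conj cn0 xc; rewrite -/n0 in E1 E2.
apply/eqP; rewrite /p 3!hornerD !hornerCM !hornerXn hornerX hornerC.
have E3 : x ^+ (Q * 9) * (x ^+ 81 + 1) = - n0 ^+ 9.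
  transitivity ((x ^+ Q * (x ^+ 9 + 1)) ^+ 9); last by rewrite E1 exprNn -signr_odd /= expr1 mulN1r.
  by rewrite exprMn expr9D expr1n -!exprM.
have {}E2 : x * x ^+ (Q * 9) = - n0 - x by rewrite -E2; ring.
transitivity (- (x * x ^+ (Q * 9)) * (x ^+ 81 + 1) - n0 ^+ 9 * x); first by rewrite E2; ring.
by rewrite -mulNr -mulrA E3; ring.
Qed.

Lemma hrad0 (c : F) : 0 \in hrad c.
Proof. by rewrite inE !expr0n !mulr0 muln_eq0 gtn_eqF ?Q_gt0 //= !addr0. Qed.

Lemma hradMl (c u w : F) : u ^+ 80 = 1 -> w \in hrad c -> u * w \in hrad c.
Proof.
move=> u80; rewrite !inE !exprMn => /eqP rw.
have -> : u ^+ 81 = u by rewrite exprS u80 mulr1.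
have -> : u ^+ (Q * 9) = u.
  rewrite Q_mod80 (_ : (80 * s + 9) * 9 = 80 * (9 * s + 1) + 1)%N; last by lia.
  by rewrite exprD exprM u80 expr1n mul1r.
by apply/eqP; rewrite -[RHS](mulr0 u) -rw; ring.
Qed.

Lemma eq_hquot (c w w' : F) : c != 0 -> w != 0 -> w' != 0 ->
  (hquot c w == hquot c w') = ((w / w') ^+ 80 == 1).
Proof.
move=> cn0 wn0 w'n0; set u := w / w'; have un0 : u != 0 by rewrite mulf_neq0 ?invr_eq0.
have -> : w = u * w' by rewrite divfK.
have hn0 : hquot c w' != 0 by rewrite !mulf_neq0 ?invr_eq0 ?expf_neq0.
have -> : hquot c (u * w') = hquot c w' * (u ^+ 9 / u ^+ Q).
  by rewrite /hquot !(exprMn _ u) invfM; ring.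
rewrite -[X in _ == X]mulr1 (inj_eq (mulfI hn0)) -(inj_eq (mulIf (expf_neq0 Q un0))).
rewrite divfK ?expf_neq0 // mul1r Q_mod80 exprD -{1}[u ^+ 9]mul1r.
rewrite (inj_eq (mulIf (expf_neq0 9 un0))) eq_sym.
apply/eqP/eqP => [u1|u80]; last by rewrite exprM u80 expr1n.
(* Euclidean step: [Q ^ 2 - 1 = (Q - 9) * (Q + 9) + 80]. *)
have := expf_units un0; rewrite (_ : 80 * kappa = 80 * s * (80 * s + 18) + 80)%N; last by ring.
by rewrite exprD exprM u1 expr1n mul1r.
Qed.

Lemma card_hrad (c : F) : c != 0 -> #|hrad c| = (80 * #|hquots c| + 1)%N.
Proof.
move=> cn0; rewrite addnC (cardsD1 0 (hrad c)); congr addn.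
  by rewrite hrad0.
rewrite mulnC -sum_nat_const -sum1_card (partition_big_imset (hquot c)) /=.
apply: eq_bigr => p /imsetP[w0]; rewrite in_setD1 => /andP[w0n0 rw0] ->.
rewrite sum1_card -[RHS](card_unity_roots pr_alpha (e' := kappa)) -?card_units //.
rewrite -[RHS](card_imset _ (mulIf w0n0)); apply: eq_card => w; rewrite [LHS]unfold_in in_setD1.
apply/andP/imsetP => [[/andP[wn0 rw]]|[u]].
  by rewrite eq_hquot // => u80; exists (w / w0); rewrite ?divfK.
rewrite inE => /eqP u80 ->.
have un0 : u != 0.
  by apply: contra_eq_neq u80 => ->; rewrite expr0n eq_sym oner_eq0.
by rewrite mulf_neq0 // hradMl // eq_hquot ?mulf_neq0 // mulfK // u80.
Qed.

Lemma card_hrad_pow3 (c : F) : exists e, #|hrad c| = (3 ^ e)%N.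
Proof.
have gP : group_set (hrad c).
  apply/group_setP; split=> [|x y].
    exact: hrad0.
  rewrite !inE => /eqP rx /eqP ry; rewrite -[X in _ == X](addr0 0) -{1}rx -ry.
  rewrite -[(x * y)%g]/(x + y) (expr3XD char3 _ _ 4) [_ ^+ (Q * 9)]exprM conjD expr9D.
  by rewrite -!exprM; apply/eqP; ring.
have := cardSg (subsetT (Group gP)); rewrite cardsT cardF Q_pow3 -expnM.
by move/dvdn_pfactor => /(_ isT)[e _ ->]; exists e.
Qed.

(** The cardinal is a power of 3, is 1 modulo 80 and is at most [80 * 82 + 1 = 3 ^ 8]; since 3 has
    order 4 modulo 80, only exponents 0, 4 and 8 remain. *)
Lemma card_hrad_cases (c : F) : c != 0 ->
  exists2 v, (v <= 2)%N & #|hrad c| = (81 ^ v)%N.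
Proof.
move=> cn0; have [e De] := card_hrad_pow3 c; have := card_hrad cn0.
have := card_hquots_le82 cn0; rewrite De; set L := #|hquots c| => L82 E.
have e8 : (e <= 8)%N by rewrite -(leq_exp2l (m := 3)) // E; lia.
case: e e8 E {De} => [|[|[|[|[|[|[|[|[|e]]]]]]]]] //= _ E; try by exfalso; lia.
- by exists 0%N.
- by exists 1%N.
- by exists 2%N.
Qed.

(* If [p1 != p2] solve [p * (p ^+ (9 * Q) + 1) = - n0] then
   [(p1 - p2) ^+ (9 * Q - 1) = n0 / (p1 * p2)], and [80] divides [9 * Q - 1]. *)
Lemma hquots_separated (c1 c2 c3 p1 p2 p3 : F) :
    c1 != 0 -> c2 != 0 -> c3 != 0 ->
    c1 ^+ Q.+1 = c2 ^+ Q.+1 -> c1 ^+ Q.+1 = c3 ^+ Q.+1 ->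
    p1 \in hquots c1 -> p2 \in hquots c2 -> p3 \in hquots c3 ->
    p1 != p2 -> p1 != p3 -> c2 ^+ kappa = c3 ^+ kappa.
Proof.
move=> n1 n2 n3 N12 N13 P1 P2 P3 D12 D13.
have [p1n0 K1 _] := hquotsP n1 P1.
(* Both [c2] and [c3] are compared with [c1], whose [kappa]-th power then cancels. *)
suff step c p : c != 0 -> c1 ^+ Q.+1 = c ^+ Q.+1 -> p \in hquots c -> p1 != p ->
    (c1 * c) ^+ kappa = c1 ^+ Q.+1 ^+ kappa.
  apply: (mulfI (expf_neq0 kappa n1)); rewrite -!exprMn.
  by rewrite (step c2 p2) // (step c3 p3).
move=> cn0 Nc Pc Dp; have [pn0 Kp _] := hquotsP cn0 Pc.
rewrite exprMn -K1 -Kp -exprMn.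
have := hquotsP_conj n1 P1; have := hquotsP_conj cn0 Pc; rewrite -Nc.
move: (c1 ^+ Q.+1) => n0 E E1.
have Dn0 : p1 - p != 0 by rewrite subr_eq0.
have : (p1 - p) ^+ (Q * 9) * (p1 * p) = n0 * (p1 - p).
  rewrite exprM conjD conjN expr9D [(- _) ^+ 9]exprNn -signr_odd expr1 mulN1r -!exprM.
  have -> : n0 = - (p * (p ^+ (Q * 9) + 1)) by rewrite E opprK.
  have {}E1 : p1 * p1 ^+ (Q * 9) = p * p ^+ (Q * 9) + p - p1.
    by apply: (addIr p1); rewrite -[X in _ + X = _]mulr1 -mulrDr E1 -E; ring.
  by rewrite mulrBl mulrA (mulrC _ p1) E1; ring.
have -> : (p1 - p) ^+ (Q * 9) = (p1 - p) ^+ (80 * (9 * s + 1)) * (p1 - p).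
  by rewrite -exprSr; congr (_ ^+ _); rewrite Q_mod80; ring.
rewrite mulrAC => /(mulIf Dn0) /(congr1 (fun x => x ^+ kappa)).
by rewrite (exprMn _ _ (p1 * p)) -exprM mulnAC exprM expf_units // expr1n mul1r.
Qed.

Lemma hsum_cases (c : F) : c != 0 ->
  [\/ #|hquots c| = 0%N /\ hsum c = - Q%:R,
      #|hquots c| = 1%N /\ hsum c = 9%:R * Q%:R
    | #|hquots c| = 82%N /\ hsum c = - (81%:R * Q%:R)].
Proof.
move=> cn0; have [v v2 cv] := card_hrad_cases cn0; have cq := card_hrad cn0.
move: (hsum_eq cv); rewrite cv in cq; case: v v2 cq {cv} => [|[|[|v]]] //= _ cq ->.
- by constructor 1; split; [move: cq; lia | ring].
- by constructor 2; split; [move: cq; lia | ring].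
- by constructor 3; split; [move: cq; lia | ring].
Qed.

(** * Radicals in a family of ten forms of equal norm *)

Section Family.

Variables (I : finType) (c : I -> F) (n0 : F).
Hypothesis card_I : #|I| = 10.
Hypothesis c_neq0 : forall i, c i != 0.
Hypothesis c_norm : forall i, c i ^+ Q.+1 = n0.
Hypothesis c_inj : injective (fun i => c i ^+ kappa).

Lemma hquots_disjoint i j p : p \in hquots (c i) -> p \in hquots (c j) -> i = j.
Proof.
move=> /(hquotsP (c_neq0 i))[_ Ki _] /(hquotsP (c_neq0 j))[_ Kj _].
by apply: c_inj; rewrite /= -Ki.
Qed.

Lemma hquots_same i1 i2 i3 p1 p2 p3 :
    p1 \in hquots (c i1) -> p2 \in hquots (c i2) -> p3 \in hquots (c i3) ->
  p1 != p2 -> p1 != p3 -> i2 = i3.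
Proof.
move=> P1 P2 P3 D12 D13; apply: c_inj => /=.
by apply: (hquots_separated _ _ _ _ _ P1 P2 P3) => //; rewrite !c_norm.
Qed.

Lemma sum_hsum_cases :
  (exists2 N1, (N1 <= 2)%N & \sum_i hsum (c i) = 10%:R * (N1%:R - 1) * Q%:R) /\
    (forall i, `|hsum (c i)| <= 9%:R * Q%:R)
  \/ \sum_i hsum (c i) = - (90%:R * Q%:R) /\ (forall i, hsum (c i) < 0).
Proof.
have Q0 : 0 < Q%:R :> algC by rewrite ltr0n Q_gt0.
case: (pickP (fun i => (2 < #|hquots (c i)|)%N)) => [i0 c_i0|small]; [right|left].
  have Hi0 : hsum (c i0) = - (81%:R * Q%:R).
    by case: (hsum_cases (c_neq0 i0)) c_i0 => [[-> _]|[-> _]|[_ ->]].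
  have Hi i : i != i0 -> hsum (c i) = - Q%:R.
    move=> ii0; suff q0 : #|hquots (c i)| = 0%N.
      by case: (hsum_cases (c_neq0 i)) => [[_ ->]|[]|[]]; rewrite ?q0.
    apply: eq_card0 => p; apply/negP => Pp; move/negP: ii0; apply; apply/eqP.
    (* One of [x], [y] differs from [p], and serves as base point against [p] and another of the
       three points. *)
    case/card_gt2P: c_i0 => x [y [z [[Px Py Pz] [xy yz zx]]]].
    have [xp|xp] := eqVneq x p; last by apply: (hquots_same Px Pp Py xp xy).
    by apply: (hquots_same Py Pp Pz _ yz); rewrite -xp eq_sym.
  split=> [|i]; last first.
    by have [->|/Hi ->] := eqVneq i i0; rewrite ?Hi0 oppr_lt0 ?mulr_gt0 ?ltr0n ?Q_gt0.
  rewrite (bigD1 i0) //= Hi0 (eq_bigr (fun=> - Q%:R)) //.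
  rewrite sumr_const (_ : #|_| = 9%N); first ring.
  by have := cardC1 i0; rewrite card_I.
have Hi i : hsum (c i) = - Q%:R + 10%:R * Q%:R * (#|hquots (c i)| == 1%N)%:R.
  case: (hsum_cases (c_neq0 i)) => [[-> ->]|[-> ->]|[E _]]; rewrite ?mulr0 ?mulr1; try ring.
  by have := small i; rewrite E.
split=> [|i]; last first.
  rewrite Hi; case: (_ == _) => /=.
    have -> : - Q%:R + 10%:R * Q%:R * 1%:R = 9%:R * Q%:R :> algC by ring.
    by rewrite ger0_norm // mulr_ge0 ?ler0n.
  by rewrite mulr0 addr0 normrN ger0_norm ?ler0n // ler_peMl ?ler0n ?ler1n.
exists #|[set i | #|hquots (c i)| == 1%N]|.
  have ex i : i \in [set i | #|hquots (c i)| == 1%N] -> exists p, p \in hquots (c i).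
    by rewrite inE => /eqP ci; apply/card_gt0P; rewrite ci.
  (* Points from three distinct indices are distinct by disjointness, and [hquots_same] identifies
     two of the indices. *)
  rewrite leqNgt; apply/negP => /card_gt2P[x [y [z [[]]]]].
  move=> /ex[px Px] /ex[py Py] /ex[pz Pz] [xy yz zx].
  have pxy : px != py.
    by apply: contraNneq xy => E; apply/eqP/(hquots_disjoint Px); rewrite E.
  have pxz : px != pz.
    by apply: contraNneq zx => E; apply/eqP/esym/(hquots_disjoint Px); rewrite E.
  by case/eqP: yz; apply: (hquots_same Px Py Pz).
rewrite (eq_bigr _ (fun i _ => Hi i)) big_split /= sumr_const card_I -mulr_sumr.
rewrite -natr_sum -sum1dep_card [in RHS]big_mkcond /=.
have -> : (\sum_i (#|hquots (c i)| == 1%N))%N = (\sum_i if #|hquots (c i)| == 1%N then 1 else 0)%N.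
  by apply: eq_bigr => i _; case: (_ == _).
by ring.
Qed.

End Family.

(** * Reduction to Hermitian sums *)

(** By Euler's criterion the condition selects the nonzero squares. *)
Definition sqsum a := \sum_(x | x ^+ (40 * kappa) == 1) chi (a * x - x ^+ d).
Definition corrsum a := \sum_x chi (a * x - x ^+ d).
Definition gauss a := \sum_w chi (a * w ^+ 2).

Lemma square_neq0 (x : F) : x ^+ (40 * kappa) == 1 -> x != 0.
Proof.
by apply: contraTneq => ->; rewrite expr0n !muln_eq0 !addn_eq0 !andbF /= eq_sym oner_eq0.
Qed.

Lemma expr_half (x : F) : x != 0 ->
  x ^+ (40 * kappa) = 1 \/ x ^+ (40 * kappa) = -1.
Proof.
move=> xn0; have : x ^+ (40 * kappa) ^+ 2 == 1 ^+ 2.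
  by rewrite expr1n -exprM -(expf_units xn0); apply/eqP; congr (_ ^+ _); lia.
by rewrite eqf_sqr => /orP[] /eqP; [left | right].
Qed.

Lemma sum_split_squares (f : F -> algC) :
  \sum_x f x = f 0 + (\sum_(x | x ^+ (40 * kappa) == 1) f x +
    \sum_(x | x ^+ (40 * kappa) == -1) f x).
Proof.
rewrite (bigD1 0) //=; congr (_ + _); rewrite (bigID (fun x => x ^+ (40 * kappa) == 1)) /=.
congr (_ + _); apply: eq_bigl => x; apply/andP/idP => [[//]|].
- by move=> E; rewrite square_neq0.
- by case=> /expr_half[] -> //; rewrite eqxx.
- move=> /eqP E; rewrite E (oneN_neq1 char3); split=> //.
  apply: contra_eq_neq E => ->; rewrite expr0n !muln_eq0 !addn_eq0 !andbF /=.
  by rewrite eq_sym oppr_eq0 oner_eq0.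
Qed.

Lemma sum_squares (f : F -> algC) :
  \sum_w f (w ^+ 2) = f 0 + 2%:R * \sum_(x | x ^+ (40 * kappa) == 1) f x.
Proof.
rewrite -(sum_powers pr_alpha) ?card_units; last by lia.
by rewrite (bigD1 0) //= expr0n.
Qed.

(** This rests on [d * (Q - 1) = 40 * kappa * m] with [m] odd. *)
Lemma conj_nonsquare (x : F) : x ^+ (40 * kappa) = -1 -> x ^+ d ^+ Q = - x ^+ d.
Proof.
move=> E; rewrite -exprM (_ : d * Q = 40 * kappa * m + d)%N; last by rewrite Q_mod80; ring.
by rewrite exprD exprM E -signr_odd oddD oddM /= expr1 mulN1r.
Qed.

(** Nonsquares contribute only the sum of [chi (a * x)], which is -1 minus the same sum over
    squares, that is, minus half of [gauss a + 1]. *)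
Lemma corrsum_eq a : a != 0 -> 2%:R * corrsum a = 2%:R * sqsum a + 1 - gauss a.
Proof.
move=> an; have := sum_chi_mul a; rewrite (negPf an).
rewrite /corrsum /gauss (sum_squares (fun x => chi (a * x))) !sum_split_squares mul0r mulr0.
rewrite expr0n muln_eq0 expn_eq0 addn_eq0 andbF subr0 chi0 -/(sqsum a).
under eq_bigr do rewrite mulrC.
under [X in _ + (_ + X) = 0]eq_bigr do rewrite mulrC.
have -> : \sum_(x | x ^+ (40 * kappa) == -1) chi (a * x - x ^+ d)
        = \sum_(x | x ^+ (40 * kappa) == -1) chi (a * x).
  apply: eq_bigr => x /eqP E; rewrite chiD -[RHS]mulr1; congr (_ * _).
  by apply: chi_conjN; rewrite conjN conj_nonsquare.
move: (\sum_(_ | _) chi (a * _)) (\sum_(_ | _) chi (a * _)) => u v uv.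
have -> : v = - 1 - u by rewrite -[RHS]addr0 -uv; ring.
by ring.
Qed.

Lemma norm_gauss a : a != 0 -> `|gauss a| = Q%:R.
Proof.
move=> an; apply/eqP; rewrite -(eqrXn2 (n := 2)) ?normr_ge0 ?ler0n //; apply/eqP.
rewrite /gauss -(eq_bigl _ _ (fun y => in_setT y)).
rewrite (@norm_quadratic_sum _ _ (fun w => - (a * w))) => [|y w|w|w|y w _ _|w _]; rewrite ?inE //.
- rewrite cardsT cardF -natrX (_ : [set _ in _ | _] = [set 0]) ?cards1 ?muln1 //.
  by apply/setP => w; rewrite !inE oppr_eq0 mulf_eq0 (negPf an).
- by rewrite sqrrN.
- by rewrite -!chiD; congr chi; rewrite mulrN -addrr_char3 //; ring.
- under eq_bigl do rewrite inE.
  by rewrite sum_chi_mul cardsT cardF.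
Qed.

Lemma odd_d : odd d.
Proof. by rewrite oddM oddX oddD oddM. Qed.

Lemma exprNd (x : F) : (- x) ^+ d = - x ^+ d.
Proof. by rewrite exprNn -signr_odd odd_d expr1 mulN1r. Qed.

Lemma sqsumN a :
  sqsum (- a) = \sum_(x | x ^+ (40 * kappa) == 1) chi (a * x + x ^+ d).
Proof.
rewrite /sqsum (reindex_inj oppr_inj) /=; apply: eq_big => x.
  by rewrite exprNn -signr_odd oddM expr0 mul1r.
by rewrite exprNd mulrNN opprK.
Qed.

(* The [delta j] have norm 1 over GF(Q) and represent the five classes of squares modulo
   tenth powers. *)
Let delta j := alpha ^+ ((160 * s + 16) * j).
Let rho := alpha ^+ ((160 * s + 16) * (8 * kappa)).

Let pr_rho : 5.-primitive_root rho.
Proof.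
rewrite /rho (_ : _ * (8 * kappa) = 16 * kappa * (80 * s + 8))%N; last by ring.
have pr16 : 5.-primitive_root (alpha ^+ (16 * kappa)).
  by apply: (prim_root_cofactor pr_alpha); rewrite card_units; lia.
rewrite exprM (prim_root_exp_coprime _ pr16) coprime_sym prime_coprime //.
by apply/negP => /dvdnP[z]; lia.
Qed.

Let deltaX j : delta j ^+ (8 * kappa) = rho ^+ j.
Proof. by rewrite /delta /rho -!exprM mulnAC. Qed.

Let delta_neq0 j : delta j != 0. Proof. by rewrite expf_neq0. Qed.

Let delta_norm j : delta j ^+ Q.+1 = 1.
Proof.
rewrite /delta -exprM (_ : _ * _ = 80 * kappa * (2 * j))%N; last by rewrite Q_mod80; ring.
by rewrite exprM expf_units // expr1n.
Qed.

(** Each nonzero square lies in exactly one coset [delta j] times tenth powers, and [y ^+ 10] takes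
    each of its nonzero values ten times. *)
Lemma sum_delta_squares (f : F -> algC) :
  \sum_(j < 5) \sum_(y | y != 0) f (delta j * y ^+ 10)
    = 10%:R * \sum_(x | x ^+ (40 * kappa) == 1) f x.
Proof.
have E : (10 * (8 * kappa))%N = #|F|.-1 by rewrite card_units; lia.
under eq_bigr => j _ do rewrite (sum_powers pr_alpha (fun x => f (delta j * x)) E).
rewrite -mulr_sumr; congr (_ * _).
transitivity (\sum_(j < 5) \sum_(x | x ^+ (8 * kappa) == rho ^+ j) f x).
  apply: eq_bigr => j _; rewrite [RHS](reindex_inj (mulfI (delta_neq0 j))) /=.
  apply: eq_bigl => x; rewrite exprMn deltaX -[X in _ = (_ == X)]mulr1.
  by rewrite (inj_eq (mulfI _)) // expf_neq0 // expf_neq0.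
rewrite (exchange_big_dep (fun x => x ^+ (40 * kappa) == 1)) /= => [|j x _ /eqP E1].
  apply: eq_bigr => x /eqP E1.
  have [j0 Dj] : {i : 'I_5 | x ^+ (8 * kappa) = rho ^+ i}.
    by apply: (prim_rootP pr_rho); rewrite -exprM -E1; congr (_ ^+ _); lia.
  rewrite (big_pred1 j0) // => j; rewrite Dj (eq_prim_root_expr pr_rho).
  by rewrite !modn_small ?ltn_ord // eq_sym.
rewrite (_ : 40 * kappa = 8 * kappa * 5)%N; last by lia.
by rewrite exprM E1 exprAC (prim_expr_order pr_rho) expr1n.
Qed.

Lemma hsumN c : hsum (- c) = \sum_y chi (c * y ^+ 10 + y ^+ Q.+1).
Proof.
have un0 : alpha ^+ (4 * kappa) != 0 by rewrite expf_neq0.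
rewrite /hsum (reindex_inj (mulfI un0)) /=; apply: eq_bigr => y _.
by rewrite hform_iota /hform; congr chi; ring.
Qed.

(** Here [delta j ^+ d = 1] and [10 * d = 40 * kappa + (Q + 1)], so [x ^+ d] is [y ^+ (Q + 1)] up to
    the quadratic character of [y]; pairing [a] with [- a] absorbs this sign. The 1 comes from
    [y = 0]. *)
Lemma sum_hsum_delta a :
  \sum_(j < 5) (hsum (a * delta j) + hsum (- (a * delta j)))
    = 10%:R * (sqsum a + sqsum (- a) + 1).
Proof.
rewrite mulrDr mulr1 sqsumN /sqsum -big_split /=.
rewrite -(sum_delta_squares (fun x => chi (a * x - x ^+ d) + chi (a * x + x ^+ d))).
have -> : 10%:R = \sum_(j < 5) 2%:R :> algC by rewrite sumr_const card_ord; ring.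
rewrite -big_split /=; apply: eq_bigr => j _.
rewrite hsumN /hsum -big_split /= (bigD1 0) //= addrC; congr (_ + _); last first.
  by rewrite /hform !expr0n /= mulr0 subr0 addr0 chi0.
apply: eq_bigr => y yn0; rewrite /hform -(mulrA a (delta j)).
have : (delta j * y ^+ 10) ^+ d = y ^+ Q.+1 \/ (delta j * y ^+ 10) ^+ d = - y ^+ Q.+1.
  rewrite exprMn /delta -!exprM.
  rewrite (_ : _ * j * d = 80 * kappa * (j * m))%N; last by ring.
  rewrite (_ : 10 * d = 40 * kappa + Q.+1)%N; last by rewrite Q_mod80; ring.
  rewrite exprM expf_units // expr1n mul1r exprD.
  by case: (expr_half yn0) => ->; rewrite ?mul1r ?mulN1r; [left | right].
by case=> ->; rewrite ?opprK // addrC.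
Qed.

Lemma kappa_odd : odd kappa. Proof.
have -> : (kappa = 2 * (40 * s * s + 9 * s) + 1)%N by ring.
by rewrite oddD oddM.
Qed.

Lemma sqsum_addN_cases a : a != 0 ->
  [/\ exists2 N1, (N1 <= 2)%N & sqsum a + sqsum (- a) + 1 = (N1%:R - 1) * Q%:R,
      `|hsum a| <= 9%:R * Q%:R & `|hsum (- a)| <= 9%:R * Q%:R]
  \/ [/\ sqsum a + sqsum (- a) + 1 = - (9%:R * Q%:R), hsum a < 0 & hsum (- a) < 0].
Proof.
move=> an; pose c (i : 'I_5 * bool) := (-1) ^+ i.2 * (a * delta i.1).
have cn i : c i != 0 by rewrite !mulf_neq0 // signr_eq0.
have cN i : c i ^+ Q.+1 = a ^+ Q.+1.
  rewrite /c exprMn -exprM -signr_odd oddM /= (_ : odd Q = true) ?andbF; last first.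
    by rewrite Q_pow3 oddX orbT.
  by rewrite mul1r exprMn delta_norm mulr1.
have cinj : injective (fun i => c i ^+ kappa).
  move=> [i b] [j b'] /= E; rewrite /c /= in E.
  have sK e : (-1) ^+ e ^+ kappa = (-1) ^+ e :> F.
    by rewrite -exprM -signr_odd oddM kappa_odd andbT signr_odd.
  rewrite 2!(exprMn _ (_ ^+ _)) !sK in E.
  (* Eighth powers remove the sign and leave [rho ^+ i]; the sign is then read off because [kappa]
     is odd. *)
  have Dij : i = j.
    have := congr1 (fun x => x ^+ 8) E; rewrite 2!(exprMn _ (_ ^+ _)) -!exprM.
    rewrite !(mulnC _ 8) !(exprM (-1) 8) -(signr_odd _ 8) expr0 !expr1n !mul1r.
    rewrite 2!(exprMn _ a) !deltaX => /(mulfI (expf_neq0 _ an))/eqP.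
    by rewrite (eq_prim_root_expr pr_rho) !modn_small // => /eqP/val_inj.
  move: E; rewrite {}Dij => /(mulIf (expf_neq0 _ (mulf_neq0 an (delta_neq0 j)))).
  by case: b b' => [] [] //= /eqP; rewrite ?expr0 expr1 ?(eq_sym 1) (negPf (oneN_neq1 char3)).
have d0 : delta 0 = 1 by rewrite /delta muln0.
have ca : c (ord0, false) = a by rewrite /c /= mul1r d0 mulr1.
have cNa : c (ord0, true) = - a by rewrite /c /= mulN1r d0 mulr1.
have card_I : #|{: 'I_5 * bool}| = 10%N by rewrite card_prod card_ord card_bool.
have Sc : \sum_i hsum (c i) = 10%:R * (sqsum a + sqsum (- a) + 1).
  rewrite -sum_hsum_delta -(pair_bigA _ (fun j b => hsum (c (j, b)))) /=.
  by apply: eq_bigr => j _; rewrite big_bool /c /= mulN1r mul1r addrC.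
have n10 : (10%:R : algC) != 0 by rewrite pnatr_eq0.
have [[[N1 N12 E] B]|[E B]] := sum_hsum_cases card_I cn cN cinj; [left|right].
  split; [exists N1 => //|by rewrite -ca|by rewrite -cNa].
  by apply: (mulfI n10); rewrite -Sc E mulrA.
split; [|by rewrite -{1}ca|by rewrite -cNa].
by apply: (mulfI n10); rewrite -Sc E; ring.
Qed.

Lemma sqsum_mulr a b : b ^+ d = 1 -> b ^+ (40 * kappa) = 1 ->
  sqsum (a * b) = sqsum a.
Proof.
move=> bd bk; have bn0 : b != 0 by rewrite square_neq0 ?bk.
rewrite [RHS]/sqsum (reindex_inj (mulfI bn0)) /=; apply: eq_big => x.
  by rewrite exprMn bk mul1r.
by rewrite exprMn bd mul1r mulrA.
Qed.

Lemma corrsum_mulr a b : b != 0 -> b ^+ d = 1 -> corrsum (a * b) = corrsum a.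
Proof.
move=> bn0 bd; rewrite [RHS]/corrsum (reindex_inj (mulfI bn0)) /=.
by apply: eq_bigr => x _; rewrite exprMn bd mul1r mulrA.
Qed.

Lemma sqsum_conj a : sqsum (a ^+ Q) = sqsum a.
Proof.
have conj_inj : injective (fun x : F => x ^+ Q) .
  by move=> x y /= E; rewrite -(conjK x) E conjK.
rewrite /sqsum (reindex_inj conj_inj) /=; apply: eq_big => x.
  rewrite exprAC; apply/eqP/eqP => [|->]; last by rewrite expr1n.
  by move=> /(congr1 (fun y => y ^+ Q)); rewrite conjK expr1n.
by move=> _; rewrite (exprAC x) -exprMn -conjN -conjD chi_conj.
Qed.

(* [a ^+ Q] is [- a] times a [d]-th root of unity. *)
Lemma sqsumN_nonsquare a : a ^+ (40 * kappa) = -1 -> sqsum (- a) = sqsum a.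
Proof.
move=> ak; rewrite -[RHS]sqsum_conj; pose b := - a ^+ (80 * s + 8).
have -> : a ^+ Q = - a * b by rewrite mulrNN -exprS; congr (_ ^+ _); rewrite Q_mod80; lia.
rewrite sqsum_mulr //.
  rewrite /b exprNd -exprM (_ : _ * d = 40 * kappa * m)%N; last by ring.
  by rewrite exprM ak -signr_odd oddD oddM /= expr1 opprK.
rewrite /b exprNn -signr_odd oddM expr0 mul1r.
by rewrite exprAC ak -signr_odd oddD oddM.
Qed.

(** As [25 * m ^ 2 = 1 + (Q - 1) * (20 * s + 3)], the quotient [a / v] is a power of [a ^+ (Q - 1)],
    a [d]-th root of unity when [a] is a square. *)
Lemma corrsum_square (a : F) : a ^+ (40 * kappa) = 1 ->
  let v := a ^+ (25 * m ^ 2) in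
  [/\ v != 0, v \in subQ & corrsum a = corrsum v].
Proof.
move=> ak v; have an : a != 0 by rewrite square_neq0 ?ak.
split; first by rewrite expf_neq0.
  apply/subQP; rewrite /v -exprM.
  rewrite (_ : _ * Q = 40 * kappa * (5 * m) + 25 * m ^ 2)%N; last by rewrite Q_mod80; ring.
  by rewrite exprD exprM ak expr1n mul1r.
set z := (a ^+ ((80 * s + 8) * (20 * s + 3)))^-1.
have -> : a = v * z.
  apply: (mulIf (expf_neq0 ((80 * s + 8) * (20 * s + 3)) an)).
  by rewrite divfK ?expf_neq0 // -exprS; congr (_ ^+ _); ring.
rewrite corrsum_mulr ?invr_eq0 ?expf_neq0 // /z exprVn -exprM.
rewrite (_ : _ * d = 40 * kappa * (m * (20 * s + 3)))%N; last by ring.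
by rewrite exprM ak expr1n invr1.
Qed.

(** * Shifts in the half-size subfield *)

(* [j] lies in GF(81) and is anti-invariant under conjugation over GF(Q); [i4] is a square root
   of -1 and [g] a nonsquare of GF(Q), both in GF(9). *)
Let j := alpha ^+ (5 * kappa).
Let g := - j ^+ 2.
Let i4 := j ^+ 4.

Let j8 : j ^+ 8 = -1.
Proof. by rewrite /j -exprM -alphaN; congr (_ ^+ _); lia. Qed.

Let jn0 : j != 0. Proof. by rewrite expf_neq0. Qed.

Let jQ : j ^+ Q = - j.
Proof.
rewrite Q_mod80 (_ : 80 * s + 9 = 8 * (10 * s + 1) + 1)%N; last by lia.
by rewrite exprD exprM j8 -signr_odd oddD oddM /= expr1 mulN1r.
Qed.

Let gK : g \in subQ.
Proof. by apply/subQP; rewrite /g conjN exprAC jQ sqrrN. Qed.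

Let gn0 : g != 0. Proof. by rewrite oppr_eq0 expf_neq0. Qed.

Let iK : i4 \in subQ.
Proof. by apply/subQP; rewrite /i4 exprAC jQ exprNn -signr_odd expr0 mul1r. Qed.

Let i2 : i4 ^+ 2 = -1. Proof. by rewrite /i4 -exprM. Qed.

Let in0 : i4 != 0. Proof. by rewrite expf_neq0. Qed.

Let g9 : g ^+ 9 = g.
Proof.
rewrite /g exprNn -signr_odd expr1 mulN1r -exprM (_ : 2 * 9 = 8 * 2 + 2)%N //.
by rewrite exprD exprM j8 sqrrN expr1n mul1r.
Qed.

Let mul_iK y : (i4 * y \in subQ) = (y \in subQ).
Proof.
apply/idP/idP => [iy|]; last exact: subQM.
by rewrite -(mulKf in0 y) subQM ?subQV.
Qed.

Lemma sum_subQ_decomp (f : F -> algC) :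
  \sum_w f w = \sum_(p in subQ) \sum_(q in subQ) f (p + j * q).
Proof.
pose h (u : F * F) := u.1 + j * u.2.
(* The minus signs are the inverse of 2 in characteristic 3. *)
pose h' w := (- (w + w ^+ Q), - ((w - w ^+ Q) / j)) : F * F.
have hK w : h (h' w) = w.
  rewrite /h /h' /= mulrN mulrCA divff // mulr1 -opprD addrACA subrr addr0.
  by rewrite addrr_char3 ?opprK.
rewrite (reindex_onto h h') => [|w _]; last exact: hK.
rewrite pair_big /=; apply: eq_bigl => -[p q] /=; apply/eqP/andP => [[<- <-]|[/subQP Kp /subQP Kq]].
  split; apply/subQP; rewrite conjN; congr (- _); first by rewrite conjD conjK addrC.
  by rewrite exprMn conjD conjN conjK exprVn jQ invrN mulrN -mulNr opprB.
rewrite /h /h' /= conjD exprMn jQ Kp Kq; congr (_, _).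
  by rewrite mulNr addrACA subrr addr0 addrr_char3 // opprK.
have -> : p + j * q - (p + - j * q) = - (j * q) by rewrite -[RHS](addrr_char3 char3); ring.
by rewrite mulNr opprK mulrC mulKf.
Qed.

Lemma subQ_square x : x \in subQ -> x != 0 -> x ^+ (40 * kappa) = 1.
Proof.
move=> /subQP Kx xn0; have : x ^+ (80 * s + 8) = 1.
  by apply: (mulIf xn0); rewrite mul1r -exprSr -[RHS]Kx; congr (_ ^+ _); rewrite Q_mod80; lia.
rewrite (_ : 40 * kappa = (80 * s + 8) * (5 * m))%N; last by ring.
by rewrite exprM => ->; rewrite expr1n.
Qed.

(** Every element of GF(Q) is a square in [F], with roots in GF(Q) or in [j] times GF(Q); squares of
    the latter are [g * p ^+ 2], because -1 is a square in GF(Q). *)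
Lemma sum_subQ_squares (h : F -> algC) :
  \sum_(p in subQ) h (p ^+ 2) + \sum_(p in subQ) h (g * p ^+ 2)
    = 2%:R * \sum_(x in subQ) h x.
Proof.
have := sum_squares (fun x => if x \in subQ then h x else 0).
rewrite subQ0 -!big_mkcondr /=.
have -> : \sum_(x | (x ^+ (40 * kappa) == 1) && (x \in subQ)) h x
        = \sum_(x in subQ) h x - h 0.
  rewrite [in RHS](bigD1 0) ?subQ0 //= addrAC subrr add0r; apply: eq_bigl => x.
  rewrite andbC; case Kx: (x \in subQ) => //=; apply/idP/idP => [/square_neq0 //|xn0].
  by rewrite subQ_square.
have -> : \sum_(w | w ^+ 2 \in subQ) h (w ^+ 2)
    = \sum_(p in subQ) h (p ^+ 2) + (\sum_(w | w ^+ Q == - w) h (w ^+ 2) - h 0).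
  rewrite (bigID (fun w => w \in subQ)) /=; congr (_ + _).
    by apply: eq_bigl => w; apply: andb_idl => Kw; apply: subQX.
  rewrite (bigD1 0 (P := fun w => w ^+ Q == - w)) /=; last first.
    by rewrite oppr0 expr0n gtn_eqF ?Q_gt0.
  rewrite expr0n /= addrAC subrr add0r; apply: eq_bigl => w.
  rewrite !inE exprAC eqf_sqr; case: (w ^+ Q =P w) => [E|wK] /=.
    rewrite E; apply/esym/negbTE; rewrite negb_and negbK -subr_eq0 opprK.
    by rewrite addrr_char3 // oppr_eq0; case: (w =P 0).
  rewrite andbT; case: (w =P 0) wK => [->|]; rewrite ?andbT //.
  by rewrite expr0n gtn_eqF ?Q_gt0.
move=> E.
have -> : \sum_(p in subQ) h (g * p ^+ 2) = \sum_(w | w ^+ Q == - w) h (w ^+ 2).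
  rewrite [LHS](reindex_inj (mulfI in0)) [RHS](reindex_inj (mulfI jn0)) /=.
  apply: eq_big => [p|p _]; last first.
    congr h; transitivity (- (i4 ^+ 2) * (j * p) ^+ 2); first by rewrite /g; ring.
    by rewrite i2 opprK mul1r.
  by rewrite mul_iK !inE exprMn jQ mulNr eqr_opp (inj_eq (mulfI jn0)).
apply: (addIr (- h 0)); rewrite -addrA E; ring.
Qed.

(** * Gauss sums and quadratic sums over GF(Q) *)

Definition gaussQ b := \sum_(p in subQ) chi (b * p ^+ 2).
Definition powsum b := \sum_(x in subQ) chi (b * x - x ^+ m).
(** The form is [e * hform b] restricted to GF(Q), where [r ^+ (Q + 1) = r ^+ 2]. *)
Definition qsum e b := \sum_(r in subQ) chi (e * (b * r ^+ 10 - r ^+ 2)).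

Lemma norm_gaussQ b : b \in subQ -> b != 0 -> `|gaussQ b| ^+ 2 = Q%:R.
Proof.
move=> Kb bn0; rewrite /gaussQ.
rewrite (@norm_quadratic_sum _ _ (fun w => - (b * w))) => [|y w|w|w|y w _ _|w Kw].
- rewrite card_subQ (_ : [set _ in _ | _] = [set 0]) ?cards1 ?muln1 //.
  apply/setP => w; rewrite in_set in_set1 oppr_eq0 mulf_eq0 (negPf bn0) /=.
  by apply: andb_idl => /eqP->; apply: subQ0.
- exact: subQD.
- exact: subQN.
- by rewrite sqrrN.
- by rewrite -!chiD; congr chi; rewrite mulrN -addrr_char3 //; ring.
- by rewrite sum_chi_mul_subQ ?card_subQ // subQN ?subQM.
Qed.

(** Since [e ^+ 9 = e], the factor [e] comes out of the ninth power of [L w], so the radical does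
    not depend on [e]. *)
Lemma norm_qsum e b : e \in subQ -> b \in subQ -> e != 0 -> e ^+ 9 = e ->
  `|qsum e b| ^+ 2
    = (Q * #|[set w in subQ | b ^+ 9 * w ^+ 81 + b * w + w ^+ 9 == 0]|)%:R.
Proof.
move=> Ke Kb en0 e9; pose L w := e * b * w ^+ 9 + (e * b * w) ^+ root9 + e * w.
rewrite /qsum (@norm_quadratic_sum _ _ L) => [|y w|w|w|y w _ _|w Kw].
- rewrite card_subQ; congr (_ * _)%:R; apply: eq_card => w; rewrite [LHS]in_set [RHS]in_set.
  have -> : (L w == 0) = (L w ^+ 9 == 0) by rewrite expf_eq0.
  have -> : L w ^+ 9 = e * (b ^+ 9 * w ^+ 81 + b * w + w ^+ 9).
    rewrite /L 2!expr9D root9K (exprMn 9 (e * b)) (exprMn 9 e b) -(exprM w).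
    by rewrite (exprMn 9 e w) e9; ring.
  by rewrite mulf_eq0 (negPf en0).
- exact: subQD.
- exact: subQN.
- by congr (e * (b * _ - _)); rewrite ?sqrrN //; ring.
- have -> : e * (b * (y + w) ^+ 10 - (y + w) ^+ 2) =
      e * (b * y ^+ 10 - y ^+ 2) + e * (b * w ^+ 10 - w ^+ 2)
      + (y * (e * b * w ^+ 9) + (e * b * w) * y ^+ 9 - (y * (e * w) + y * (e * w))).
    by rewrite expr10D; ring.
  rewrite 2!chiD; congr (_ * _ * _); rewrite addrr_char3 // opprK 2!chiD chi_root9 -!chiD.
  by congr chi; rewrite /L; ring.
- have KL : L w \in subQ by rewrite /L !(subQD, subQM, subQX).
  by rewrite sum_chi_mul_subQ ?card_subQ.
Qed.

Lemma qsum_real e b : qsum e b \is Num.real.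
Proof.
apply: (@sum_chi_odd_real _ _ i4) => // y.
have i10 : i4 ^+ 10 = -1 by rewrite (exprM i4 2 5) i2 -signr_odd expr1.
by rewrite (exprMn _ i4) (exprMn 2 i4) i10 i2; ring.
Qed.

Lemma qsumN e b : qsum (- e) b = qsum e b.
Proof.
rewrite -[RHS](conj_Creal (qsum_real e b)) rmorph_sum /=.
by apply: eq_bigr => r _; rewrite -chiN mulNr.
Qed.

(** At [p + j * q] the form splits as its value at [p] plus [g] times its value at [q], because
    [j ^+ 10 = g]; the cross term is anti-invariant, hence invisible to [chi]. *)
Lemma qsum_mul b : b \in subQ -> qsum 1 b * qsum g b = hsum b.
Proof.
move=> /subQP Kb; rewrite /hsum sum_subQ_decomp mulr_suml; apply: eq_bigr => p /subQP Kp.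
rewrite mulr_sumr; apply: eq_bigr => q /subQP Kq; rewrite -chiD.
set z := b * j * (p ^+ 9 * q - q ^+ 9 * p).
have z1 : chi z = 1.
  apply: chi_conjN; rewrite /z (exprMn Q (b * j)) (exprMn Q b) jQ Kb conjD conjN.
  by rewrite (exprMn Q (p ^+ 9)) (exprMn Q (q ^+ 9)) (exprAC p) (exprAC q) Kp Kq; ring.
rewrite -[LHS]mulr1 -z1 -chiD; congr chi.
rewrite /hform expr10D [(p + j * q) ^+ Q.+1]exprSr conjD (exprMn Q j) jQ Kp Kq.
have j9 : j ^+ 9 = - j by rewrite exprSr j8 mulN1r.
by rewrite (exprMn 9 j) j9 /g /z; ring.
Qed.

(** Fifth powers permute GF(Q), so put [x = u ^+ 5] and split [u] into [p ^+ 2] and [g * p ^+ 2];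
    then [2 * (5 * m) = Q + 1] restores the quadratic form. *)
Lemma powsum_eq b : b \in subQ -> 2%:R * powsum b = qsum 1 b + qsum g b.
Proof.
move=> Kb; have K25 x : x \in subQ -> x ^+ (5 * m ^ 2) ^+ 5 = x.
  move=> Kx; rewrite -exprM (_ : _ * 5 = (80 * s + 8) * (20 * s + 3) + 1)%N; last by ring.
  have [->|xn0] := eqVneq x 0; first by rewrite addn1 exprS mul0r.
  rewrite exprD exprM (_ : x ^+ (80 * s + 8) = 1) ?expr1n ?mul1r //.
  apply: (mulIf xn0); rewrite mul1r -exprSr -[RHS](subQP _ Kx).
  by congr (_ ^+ _); rewrite Q_mod80; lia.
have -> : powsum b = \sum_(u in subQ) chi (b * u ^+ 5 - u ^+ (5 * m)).
  rewrite /powsum (reindex_onto (fun u => u ^+ 5) (fun x => x ^+ (5 * m ^ 2))) /=; last exact: K25.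
  apply: eq_big => [u|u _]; last by rewrite -exprM.
  apply/andP/idP => [[K5 /eqP <-]|Ku]; first exact: subQX.
  by rewrite subQX // exprAC K25.
rewrite -(sum_subQ_squares (fun u => chi (b * u ^+ 5 - u ^+ (5 * m)))) -(qsumN g).
have p10 p : p \in subQ -> p ^+ 2 ^+ (5 * m) = p ^+ 2.
  move=> /subQP Kp; rewrite -exprM (_ : 2 * (5 * m) = Q.+1)%N; last by rewrite Q_mod80; lia.
  by rewrite exprSr Kp expr2.
have g4 : g ^+ 4 = -1 by rewrite /g exprNn -signr_odd expr0 mul1r -exprM.
have g5 : g ^+ 5 = - g by rewrite exprS g4 mulrN1.
have g5m : g ^+ (5 * m) = - g.
  rewrite exprM g5 exprNn -signr_odd oddD oddM /= expr1 mulN1r exprD expr1.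
  by rewrite (_ : 8 * s = 4 * (2 * s))%N ?exprM ?g4 ?sqrrN ?expr1n ?mul1r //; lia.
congr (_ + _); apply: eq_bigr => p Kp; congr chi.
  by rewrite p10 // -exprM mul1r.
by rewrite !(exprMn _ g) p10 // g5 g5m -exprM; ring.
Qed.

(* With [w = p + j * q], [A = p ^+ 2] and [B = g * q ^+ 2], the sum for [- a] is the sum for
   [a] with [A] and [B] exchanged. By [sum_subQ_squares] their difference only involves sums
   in which one of [A], [B] runs over all of GF(Q). *)
Lemma sqsum_subN a : a \in subQ ->
  sqsum a - sqsum (- a) = gaussQ (- a) * powsum (- a) - gaussQ a * powsum a.
Proof.
move=> /subQP Ka; pose phi A B := chi (a * (A - B) - (A + B) ^+ m).
have sq_phi b : b ^+ Q = b -> 2%:R * sqsum b + 1 = \sum_(p in subQ) \sum_(q in subQ)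
    chi (b * (p ^+ 2 - g * q ^+ 2) - (p ^+ 2 + g * q ^+ 2) ^+ m).
  move=> Kb; have := sum_squares (fun x => chi (b * x - x ^+ d)).
  rewrite mulr0 expr0n muln_eq0 expn_eq0 addn_eq0 andbF subr0 chi0 addrC => <-.
  rewrite sum_subQ_decomp; apply: eq_bigr => p /subQP Kp; apply: eq_bigr => q /subQP Kq.
  set z := - (b * j * p * q).
  have z1 : chi z = 1.
    by apply: chi_conjN; rewrite /z conjN !(exprMn Q) jQ Kb Kp Kq; ring.
  rewrite -[RHS]mulr1 -z1 -chiD; congr chi.
  rewrite -exprM (_ : 2 * d = Q.+1 * m)%N; last by rewrite Q_mod80; ring.
  rewrite exprM [(p + j * q) ^+ Q.+1]exprSr conjD (exprMn Q) jQ Kp Kq.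
  have -> : (p + - j * q) * (p + j * q) = p ^+ 2 + g * q ^+ 2 by rewrite /g; ring.
  rewrite /z -(addrr_char3 char3 (b * j * p * q)) /g; ring.
have E1 := sq_phi a Ka.
have E2 : 2%:R * sqsum (- a) + 1 = \sum_(p in subQ) \sum_(q in subQ) phi (g * q ^+ 2) (p ^+ 2).
  rewrite sq_phi ?conjN ?Ka //; apply: eq_bigr => p _; apply: eq_bigr => q _.
  by rewrite /phi (addrC (g * _) (p ^+ 2)); congr chi; ring.
have n2 : (2%:R : algC) != 0 by rewrite pnatr_eq0.
apply: (mulfI n2).
transitivity (\sum_(p in subQ) (2%:R * \sum_(B in subQ) phi (p ^+ 2) B)
            - \sum_(p in subQ) (2%:R * \sum_(A in subQ) phi A (p ^+ 2))).
  transitivity (2%:R * sqsum a + 1 - (2%:R * sqsum (- a) + 1)); first by ring.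
  rewrite E1 E2.
  under [X in _ = X - _]eq_bigr => p _ do rewrite -(sum_subQ_squares (phi (p ^+ 2))).
  under [X in _ = _ - X]eq_bigr => p _ do
    rewrite -(sum_subQ_squares (fun A => phi A (p ^+ 2))).
  (* The terms in which both arguments are squares cancel after the exchange. *)
  rewrite !big_split /= [X in _ = X + _ - _]exchange_big /=.
  by rewrite opprD addrACA subrr add0r.
rewrite -!mulr_sumr -mulrBr; congr (_ * (_ - _)).
  rewrite /gaussQ mulr_suml; apply: eq_bigr => p Kp.
  rewrite (reindex_inj (addIr (- p ^+ 2))) /powsum mulr_sumr /=.
  apply: eq_big => [x|x _].
    apply/idP/idP => [K1|Kx]; last by rewrite subQD ?subQN ?subQX.
    by rewrite -(subrK (p ^+ 2) x) subQD ?subQX.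
  rewrite /phi -chiD; congr chi; rewrite subrKC.
  by rewrite [in RHS]mulNr -(addrr_char3 char3 (a * p ^+ 2)); ring.
rewrite /gaussQ mulr_suml; apply: eq_bigr => p Kp.
rewrite (reindex_inj (addIr (- p ^+ 2))) /powsum mulr_sumr /=.
apply: eq_big => [x|x _].
  apply/idP/idP => [K1|Kx]; last by rewrite subQD ?subQN ?subQX.
  by rewrite -(subrK (p ^+ 2) x) subQD ?subQX.
rewrite /phi -chiD; congr chi; rewrite subrK.
by rewrite -[in RHS](opprK (a * p ^+ 2)) -(addrr_char3 char3 (a * p ^+ 2)); ring.
Qed.

Lemma norm_qsum_eq b : b \in subQ -> `|qsum 1 b| = `|qsum g b|.
Proof.
move=> Kb; apply/eqP; rewrite -(eqrXn2 (n := 2)) ?normr_ge0 //.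
by rewrite !norm_qsum ?subQ1 ?oner_eq0 ?expr1n.
Qed.

(** [powsum b] is the mean of two sums of common modulus, whose square is the modulus of [hsum b],
    and [gaussQ b] has modulus the square root of [Q]. *)
Lemma norm_gaussQ_powsum b : b \in subQ -> b != 0 ->
  `|hsum b| <= 9%:R * Q%:R -> `|gaussQ b * powsum b| <= 3%:R * Q%:R.
Proof.
move=> Kb bn0; rewrite -qsum_mul // normrM -norm_qsum_eq // -expr2 => le9.
have pw : `|powsum b| <= `|qsum 1 b|.
  rewrite -(ler_pM2l (ltr0Sn _ 1)) -[X in X * `|powsum b|](ger0_norm (ler0n _ 2)) -normrM.
  by rewrite powsum_eq // (le_trans (ler_normD _ _)) // -norm_qsum_eq // -mulr2n mulr_natl.
have Q0 : 0 <= Q%:R :> algC by rewrite ler0n.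
rewrite -ler_sqr ?nnegrE ?normr_ge0 ?mulr_ge0 ?ler0n // normrM exprMn norm_gaussQ //.
have -> : (3%:R * Q%:R) ^+ 2 = Q%:R * (9%:R * Q%:R) :> algC by ring.
rewrite ler_wpM2l // (le_trans _ le9) //.
by rewrite ler_sqr ?nnegrE ?normr_ge0.
Qed.

(** Two real numbers of equal modulus and negative product are opposite. *)
Lemma powsum0 b : b \in subQ -> hsum b < 0 -> powsum b = 0.
Proof.
move=> Kb; rewrite -qsum_mul // => neg.
have n2 : (2%:R : algC) != 0 by rewrite pnatr_eq0.
apply: (mulfI n2); rewrite mulr0 powsum_eq //; apply/eqP; rewrite addr_eq0.
have : qsum 1 b ^+ 2 == qsum g b ^+ 2.
  rewrite -(real_normK (qsum_real 1 b)) -(real_normK (qsum_real g b)).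
  by rewrite norm_qsum_eq.
rewrite eqf_sqr => /orP[/eqP E|//]; move: neg; rewrite E -expr2.
by rewrite le_gtF // real_exprn_even_ge0 // qsum_real.
Qed.

(** Twice the sum has three parts, bounded by [Q], [6 * Q] and [Q], or, when some radical is a
    plane, by [9 * Q], 0 and [Q]. *)
Lemma norm_corrsum_subQ a : a \in subQ -> a != 0 -> `|corrsum a| <= 5%:R * Q%:R.
Proof.
move=> Ka an; have Q0 : 0 <= Q%:R :> algC by rewrite ler0n.
rewrite -(ler_pM2l (ltr0Sn algC 1)) -[X in X * `|_|](ger0_norm (ler0n _ 2)) -normrM.
have -> : 2%:R * corrsum a = (sqsum a + sqsum (- a) + 1)
    + (gaussQ (- a) * powsum (- a) - gaussQ a * powsum a) - gauss a.
  by rewrite corrsum_eq // -sqsum_subN //; ring.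
have Nan : - a != 0 by rewrite oppr_eq0.
have KNa := subQN Ka.
rewrite (le_trans (ler_normB _ _)) // norm_gauss //.
rewrite (le_trans (lerD (ler_normD _ _) (lexx _))) //.
case: (sqsum_addN_cases an) => [[[N1 N12 ->] Ha HNa]|[-> Ha HNa]].
  rewrite normrM (ger0_norm Q0) (le_trans (y := 1 * Q%:R + 6%:R * Q%:R + Q%:R)) //.
    rewrite lerD // lerD //.
      apply: ler_wpM2r => //; case: N1 N12 => [|[|[|//]]] _.
      - by rewrite sub0r normrN1.
      - by rewrite subrr normr0.
      - by rewrite mulrSr addrK normr1.
    rewrite (le_trans (ler_normB _ _)) // (_ : 6%:R * _ = 3%:R * Q%:R + 3%:R * Q%:R); last by ring.
    by rewrite lerD // norm_gaussQ_powsum.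
  rewrite (_ : _ + Q%:R = 8%:R * Q%:R); last by ring.
  by rewrite mulrA ler_wpM2r // -natrM ler_nat.
rewrite !powsum0 // !mulr0 subrr normr0 addr0 normrN normrM !ger0_norm ?ler0n //.
by rewrite le_eqVlt; apply/orP; left; apply/eqP; ring.
Qed.

Lemma norm_corrsum a : a != 0 -> `|corrsum a| <= 5%:R * Q%:R.
Proof.
move=> an; case: (expr_half an) => [/corrsum_square[vn Kv ->]|ak].
  exact: norm_corrsum_subQ.
have Q0 : 0 <= Q%:R :> algC by rewrite ler0n.
rewrite -(ler_pM2l (ltr0Sn algC 1)) -[X in X * `|_|](ger0_norm (ler0n _ 2)) -normrM.
have -> : 2%:R * corrsum a = (sqsum a + sqsum (- a) + 1) - gauss a.
  by rewrite corrsum_eq // sqsumN_nonsquare //; ring.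
rewrite (le_trans (ler_normB _ _)) // norm_gauss //.
have -> : 2%:R * (5%:R * Q%:R) = 9%:R * Q%:R + Q%:R :> algC by ring.
rewrite lerD //; case: (sqsum_addN_cases an) => [[[N1 N12 ->] _ _]|[-> _ _]].
  rewrite normrM (ger0_norm Q0) ler_wpM2r // (le_trans (y := 1)) ?ler1n //.
  case: N1 N12 => [|[|[|//]]] _.
  - by rewrite sub0r normrN1.
  - by rewrite subrr normr0.
  - by rewrite mulrSr addrK normr1.
by rewrite normrN normrM !ger0_norm ?ler0n.
Qed.

End CrossCorrelation.

(** * From the correlation to the character sum *)

Lemma pow9_odd_mod80 k : odd k -> exists s, (3 ^ (2 * k) = 80 * s + 9)%N.
Proof.
move=> ok; rewrite -(odd_double_half k) ok; elim: (k./2) => [|l [s IH]].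
  by exists 0%N.
(* [81 * (80 * s + 9) = 80 * (81 * s + 9) + 9]. *)
exists (81 * s + 9)%N; rewrite doubleS.
by rewrite (_ : 2 * _ = 2 * (true + l.*2) + 4)%N ?expnD ?IH; lia.
Qed.

Theorem theorem1 (k : nat) (F : finFieldType) (alpha : F) (tau : nat) :
  odd k -> (0 < k)%N ->
  #|F| = (3 ^ (4 * k))%N ->
  (#|F|.-1).-primitive_root alpha ->
  (tau <= 3 ^ (4 * k) - 2)%N ->
  `|crosscorr (4 * k) alpha (((3 ^ (2 * k) + 1) ^ 2) %/ 20) tau|
    <= 5%:R * sqrtC (3%:R ^+ (4 * k)) + 1.
Proof.
move=> odd_k k_gt0 cardF pr_alpha _.
have [s Qs] := pow9_odd_mod80 odd_k; set Q := (3 ^ (2 * k))%N in Qs *.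
have char3 := card_finPcharP cardF (isT : prime 3).
have cardF2 : #|F| = (Q ^ 2)%N by rewrite cardF -expnM; congr (_ ^ _)%N; lia.
have -> : ((Q + 1) ^ 2 %/ 20 = 5 * (8 * s + 1) ^ 2)%N.
  by rewrite Qs (_ : (_ + 1) ^ 2 = 5 * (8 * s + 1) ^ 2 * 20)%N ?mulnK //; ring.
have sqQ : 3%:R ^+ (4 * k) = Q%:R ^+ 2 :> algC.
  by rewrite -!natrX; congr _%:R; rewrite -cardF.
rewrite sqQ sqrCK ?ler0n //; pose chi := @trace_char F (4 * k).
have chiD : forall x y, chi (x + y) = chi x * chi y by apply: trace_charD.
have chi0 : chi 0 = 1.
  rewrite /chi /trace_char /absTr big1 ?(omega_powE char3) // => i _.
  by rewrite expr0n expn_eq0.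
have alpha_n0 : alpha != 0 by rewrite -finfield_unity_root (prim_expr_order pr_alpha).
(* The powers of [alpha] run over the units; the subtracted 1 is the term at [x = 0]. *)
have -> : crosscorr (4 * k) alpha (5 * (8 * s + 1) ^ 2) tau
    = corrsum s chi (alpha ^+ tau) - 1.
  rewrite /corrsum (bigD1 0) //= mulr0 expr0n muln_eq0 expn_eq0 addn_eq0 andbF subr0 chi0.
  rewrite addrAC subrr add0r (sum_neq0_prim_root pr_alpha) cardF -subn1 /crosscorr.
  apply: eq_bigr => t _; rewrite /chi /trace_char /mseq -absTrB //.
  by rewrite -exprM exprD (mulrC (alpha ^+ t)) (mulnC t).
rewrite (le_trans (ler_normB _ _)) // normr1 lerD2r.
apply: (@norm_corrsum F alpha Q k s chi) => //.
- by move=> x; apply: trace_char_frob.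
- by apply: trace_char_nontrivial => //; lia.
- by rewrite expf_neq0.
Qed.
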